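(* Among $n$-vertex trees, the value of $\mathring{s}$ is minimized by the star $K_{1,n-1}$ and maximized by the path $P_n$. Furthermore, with $u_t=\left\lfloor\frac{-1+\sqrt{8t+1}}{2}\right\rfloor$, for every $n\ge 1$ and every $n$-vertex tree $T$, $$n+u_{n-1}=\mathring{s}(K_{1,n-1})\le \mathring{s}(T)\le \mathring{s}(P_n)=\left\lfloor \frac{3n}{2}\right\rfloor,$$ where $u_{n-1}\sim\sqrt{2n}$ as $n\to\infty$.
   Context: All graphs are finite and simple. The slow-coloring game on a graph $G$ is played by Lister and Painter. On each round, Lister marks a nonempty subset $M$ of the uncolored vertices, scoring $|M|$ points; Painter then colors (with a new color) a subset of $M$ that is independent in $G$. The game ends when all vertices are colored. Painter wants to minimize the total score and Lister wants to maximize it. The sum-color cost $\mathring{s}(G)$ is the total score under optimal play by both players (the score that each player can guarantee doing no worse than). $P_n$ is the path with $n$ vertices and $K_{1,n-1}$ is the star with $n$ vertices. *)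

(* Defs.v *)
From HB Require Import structures.
From mathcomp Require Import all_boot all_order all_algebra.
From mathcomp Require Import all_classical all_reals all_analysis.

Set Implicit Arguments.
Unset Strict Implicit.
Unset Printing Implicit Defensive.

Import Order.TTheory GRing.Theory Num.Theory.
Import numFieldNormedType.Exports.

Record sgraph := SGraph {
  vertex :> finType;
  edge : rel vertex;
  edge_sym : symmetric edge;
  edge_irrefl : irreflexive edge }.

Definition graph_connected (G : sgraph) : Prop :=
  forall x y : G, connect (@edge G) x y.

(* mathcomp's [cycle] accepts sequences of length at most 2, such as the
   closed walk x, y, x along an edge; the cycles of a simple graph are those
   with at least 3 distinct vertices. *)
Definition graph_acyclic (G : sgraph) : Prop :=
  forall c : seq G, uniq c -> cycle (@edge G) c -> size c <= 2.

Definition is_tree (G : sgraph) : Prop :=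
  [/\ 0 < #|G|, graph_connected G & graph_acyclic G].

Definition tree_on (n : nat) (G : sgraph) : Prop := #|G| = n /\ is_tree G.

Definition path_edge (n : nat) : rel 'I_n :=
  fun i j => (i.+1 == j :> nat) || (j.+1 == i :> nat).

Lemma path_edge_sym n : symmetric (@path_edge n).
Proof. by move=> i j; rewrite /path_edge orbC. Qed.

Lemma path_edge_irrefl n : irreflexive (@path_edge n).
Proof. by move=> i; rewrite /path_edge orbb (gtn_eqF (ltnSn i)). Qed.

Definition path_graph (n : nat) : sgraph :=
  SGraph (@path_edge_sym n) (@path_edge_irrefl n).

Definition bipartite_edge (a b : nat) : rel ('I_a + 'I_b)%type :=
  fun x y => match x, y with
             | inl _, inr _ | inr _, inl _ => true
             | _, _ => false
             end.

Lemma bipartite_edge_sym a b : symmetric (@bipartite_edge a b).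
Proof. by case=> [x|x] [y|y]. Qed.

Lemma bipartite_edge_irrefl a b : irreflexive (@bipartite_edge a b).
Proof. by case. Qed.

Definition complete_bipartite (a b : nat) : sgraph :=
  SGraph (@bipartite_edge_sym a b) (@bipartite_edge_irrefl a b).

(* K_(1, n-1), which has n vertices when n >= 1. *)
Definition star_graph (n : nat) : sgraph := complete_bipartite 1 n.-1.

Definition independent (G : sgraph) (I : {set G}) : bool :=
  [forall x in I, forall y in I, ~~ edge x y].

(* A position of the slow-coloring game is the set [A] of uncolored vertices. *)
Definition lister_move (G : sgraph) (A M : {set G}) : bool :=
  (M != finset.set0) && (M \subset A).

(* [I] may be empty. *)
Definition painter_move (G : sgraph) (M I : {set G}) : bool :=
  (I \subset M) && independent I.

(* [painter_guarantees A k]: from position [A], Painter has a strategy such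
   that, however Lister plays, the game ends with at most [k] further points
   scored. *)
Inductive painter_guarantees (G : sgraph) : {set G} -> nat -> Prop :=
| PainterEnd k : painter_guarantees finset.set0 k
| PainterRound A k (reply : {set G} -> {set G}) :
    (forall M, lister_move A M -> #|M| <= k) ->
    (forall M, lister_move A M -> painter_move M (reply M)) ->
    (forall M, lister_move A M ->
       painter_guarantees (A :\: reply M) (k - #|M|)) ->
    painter_guarantees A k.

(* [lister_guarantees A k]: from position [A], Lister has a strategy such that,
   however Painter plays, at least [k] further points are scored; the truncated
   subtraction covers a mark of more than the [k] points still required. *)
Inductive lister_guarantees (G : sgraph) : {set G} -> nat -> Prop :=
| ListerEnd A : lister_guarantees A 0
| ListerRound A k M :
    lister_move A M ->
    (forall I, painter_move M I -> lister_guarantees (A :\: I) (k - #|M|)) ->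
    lister_guarantees A k.

Lemma painter_lister_le (G : sgraph) (A : {set G}) (k l : nat) :
  painter_guarantees A k -> lister_guarantees A l -> l <= k.
Proof.
move=> pA; elim: pA l => {A k} [k|A k reply bnd legal _ IH] l lA.
  have empty_end B : lister_guarantees B l -> B = finset.set0 -> l <= k.
    case=> // {}B m M /andP[M0 MB] _ B0.
    by move: MB; rewrite B0 finset.subset0 (negbTE M0).
  exact: empty_end lA erefl.
case: lA bnd legal IH => // B m M hM hI bnd legal IH.
by have := IH M hM _ (hI _ (legal M hM)); rewrite leq_subLR subnKC // bnd.
Qed.

Lemma painter_or_lister (G : sgraph) (k : nat) (A : {set G}) :
  painter_guarantees A k \/ lister_guarantees A k.+1.
Proof.
elim/ltn_ind: k A => k IH A.
pose good (M I : {set G}) := [/\ #|M| <= k, painter_move M I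
                   & painter_guarantees (A :\: I) (k - #|M|)].
have [all_good|] := pselect (forall M, lister_move A M -> exists I, good M I).
  left; have /choice[reply h] M : exists I, lister_move A M -> good M I.
    have [/all_good[I gI]|nM] := boolP (lister_move A M); first by exists I.
    by exists finset.set0.
  by apply: (@PainterRound _ _ _ reply) => M /h[].
move=> /existsNP[M /not_implyP[hM /forallNP bad]].
right; apply: (ListerRound hM) => I hI.
have [leMk|ltkM] := leqP #|M| k; last first.
  by have /eqP-> : k.+1 - #|M| == 0; [rewrite subn_eq0 | exact: ListerEnd].
rewrite subSn //; have M_gt0 : 0 < #|M|.
  by case/andP: hM => M0 _; rewrite card_gt0.
have ltk : k - #|M| < k by rewrite ltn_subrL M_gt0 (leq_trans M_gt0).
by have [pI|//] := IH _ ltk (A :\: I); case: (bad I); split.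
Qed.

Lemma painter_guarantees_some (G : sgraph) (n k : nat) (A : {set G}) :
  #|A| <= n -> n * #|G| <= k -> painter_guarantees A k.
Proof.
elim: n k A => [|n IH] k A leA lek.
  by move: leA; rewrite leqn0 cards_eq0 => /eqP->; exact: PainterEnd.
pose reply (M : {set G}) := if [pick x in M] is Some x then [set x]%SET
                            else finset.set0.
have replyP M : lister_move A M ->
    exists x, [/\ x \in M, x \in A & reply M = [set x]%SET].
  case/andP=> M0 /fintype.subsetP MA; rewrite /reply.
  case: pickP => [x xM|M_empty]; first by exists x; split=> //; exact: MA.
  by case/finset.set0Pn: M0 => x; rewrite M_empty.
have leM (M : {set G}) : n * #|G| + #|M| <= k.
  by apply: leq_trans lek; rewrite mulSn addnC leq_add2r max_card.
apply: (@PainterRound _ _ _ reply) => M /replyP[x [xM xA replyM]].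
- exact: leq_trans (leq_addl _ _) (leM M).
- rewrite replyM /painter_move finset.sub1set xM /independent.
  apply/'forall_in_forall_inP => y /finset.set1P-> z /finset.set1P->.
  by rewrite edge_irrefl.
- rewrite replyM; apply: IH; first by move: leA; rewrite (cardsD1 x A) xA.
  by rewrite leq_subRL ?(leq_trans (leq_addl _ _) (leM M)) // addnC.
Qed.

Lemma slow_coloring_determined (G : sgraph) :
  exists s, painter_guarantees [set: G]%SET s /\
            lister_guarantees [set: G]%SET s.
Proof.
pose P k := `[< painter_guarantees [set: G]%SET k >].
have exP : exists k, P k.
  exists (#|G| * #|G|); apply/asboolP; apply: painter_guarantees_some (leqnn _).
  exact: max_card.
case: (ex_minnP exP) => -[|k] /asboolP pk mink.
  by exists 0; split=> //; exact: ListerEnd.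
exists k.+1; split=> //; case: (painter_or_lister k [set: G]%SET) => // pk'.
by have := mink k (asboolT pk'); rewrite ltnn.
Qed.

(* The total score that each player can guarantee doing no worse than. *)
Definition sum_color_cost (G : sgraph) : nat :=
  sval (cid (slow_coloring_determined G)).

Lemma sum_color_costP (G : sgraph) (s : nat) :
  painter_guarantees [set: G]%SET s /\ lister_guarantees [set: G]%SET s <->
  sum_color_cost G = s.
Proof.
rewrite /sum_color_cost; case: cid => s' /= [p' l']; split=> [[p l]|<- //].
by apply/eqP; rewrite eqn_leq (painter_lister_le p' l) (painter_lister_le p l').
Qed.

Local Open Scope ring_scope.

Definition u (R : realType) (t : nat) : int :=
  Num.floor ((-1 + Num.sqrt (8 * t%:R + 1)) / 2 : R).

(* Main.v *)
Require Import Defs.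
From mathcomp Require Import all_boot all_order all_algebra.
From mathcomp Require Import all_classical all_reals all_analysis.
From mathcomp Require Import zify lra.

Set Implicit Arguments.
Unset Strict Implicit.
Unset Printing Implicit Defensive.

Import Order.TTheory GRing.Theory Num.Theory.
Import numFieldNormedType.Exports.

(** Write t_k = k(k+1)/2 and let k = [triangular_root t] be the largest k with
    t_k <= t; solving the quadratic inequality identifies it with u_t.

    Lister's side rests on one principle: whatever Lister can guarantee on
    disjoint vertex sets adds up, because the edges between them only restrict
    Painter ([lister_guaranteesU]).  A connected graph has a spanning star or
    a partition into two connected parts with at least two vertices each
    ([star_or_split]).  In the second case u_(a+b+1) <= u_a + u_b lets an
    induction conclude.  In a star with m leaves, Lister marks the centre and u_m
    leaves.  If Painter colors the centre, the m leaves are still worth one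
    point each; otherwise a star remains that has lost at most u_m leaves, and u
    has dropped by at most one.  So every tree costs at least n + u_(n-1).  On a
    path, splitting into edges, each worth 3 points, gives floor(3n/2).

    Painter attains the lower bound on the star: when the centre is marked,
    Painter colors it if at most u_m leaves are marked with it, and the marked
    leaves if there are more, and then u drops by at least one.

    On a tree, Painter keeps (3|A| - o)/2 as an upper bound for the future score
    on the set A of uncolored vertices, where o is the number of components of
    odd order of the forest induced by A.  This works if every marked set M
    contains an independent set I such that 2|M| + o <= 3|I| + o', o' being the
    number of odd components after I is removed.  Such an I is found by
    induction on a rooted tree built up along edges ([rooted_tree_reply]).  If
    the root is unmarked there is a reply good enough even when the component of
    the root is not counted.  If the root is marked, there is a reply using the
    root and one avoiding it that are good enough on average, up to an error
    that parity removes once the component of the root is counted. *)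

(** * Triangular roots *)

Section SlowColoring.
Import mathcomp.boot.fintype mathcomp.boot.finset.
Local Open Scope nat_scope.
Local Open Scope set_scope.

Lemma triangular_root_exists t :
  exists k, k * k.+1 <= t.*2 < k.+1 * k.+2.
Proof.
elim: t => [|t [k kP]]; first by exists 0.
have [le|lt] := leqP (k.+1 * k.+2) t.+1.*2; last by exists k; lia.
by exists k.+1; nia.
Qed.

Definition triangular_root t : nat := xchoose (triangular_root_exists t).

Lemma leq_triangular_root k t : (k <= triangular_root t) = (k * k.+1 <= t.*2).
Proof.
rewrite /triangular_root; have := xchooseP (triangular_root_exists t).
by move: (xchoose _) => u uP; apply/idP/idP; nia.
Qed.

Lemma triangular_root_bounds t (r := triangular_root t) :
  r * r.+1 <= t.*2 < r.+1 * r.+2.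
Proof. exact: (xchooseP (triangular_root_exists t)). Qed.

Lemma triangular_root0 : triangular_root 0 = 0.
Proof. by have := triangular_root_bounds 0; nia. Qed.

Lemma triangular_root_homo : {homo triangular_root : s t / s <= t}.
Proof.
move=> s t st; rewrite leq_triangular_root.
by have /andP[le _] := triangular_root_bounds s; lia.
Qed.

(** The term +1 is the edge that is lost when a tree with a + b + 1 edges is cut
    into trees with a and b edges; it is affordable because both pieces have an
    edge, so that both roots are at least 1. *)
Lemma triangular_root_subadditive a b : 0 < a -> 0 < b ->
  triangular_root (a + b).+1 <= triangular_root a + triangular_root b.
Proof.
move=> a0 b0; rewrite leqNgt leq_triangular_root -ltnNge.
have: 0 < triangular_root a by rewrite leq_triangular_root; lia.
have: 0 < triangular_root b by rewrite leq_triangular_root; lia.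
move: (triangular_root_bounds a) (triangular_root_bounds b).
move: (triangular_root a) (triangular_root b) => k l.
(* For k = l = 1 the slack comes from 2a and 2b being even. *)
have [->|k1] := eqVneq k 1; have [->|l1] := eqVneq l 1; nia.
Qed.

(** Since t_k - k = t_(k-1), subtracting the root lowers it by at most one, and
    subtracting more than the root lowers it by at least one. *)
Lemma triangular_root_drop t : 0 < t ->
  triangular_root t <= (triangular_root (t - triangular_root t)).+1.
Proof.
move=> t0.
have: triangular_root t - 1 <= triangular_root (t - triangular_root t).
  rewrite leq_triangular_root; move: (triangular_root_bounds t).
  by case: (triangular_root t) => [|k]; nia.
by lia.
Qed.

Lemma triangular_root_drop_lt t m : triangular_root t < m -> m <= t ->
  triangular_root (t - m) < triangular_root t.
Proof.
move=> km mt; rewrite ltnNge leq_triangular_root -ltnNge.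
by have := triangular_root_bounds t; nia.
Qed.

(** * General strategies *)

Implicit Types G : sgraph.

Lemma sum_color_cost_le G k :
  painter_guarantees [set: G] k -> sum_color_cost G <= k.
Proof.
by move=> pk; have [_ /(_ erefl)[_]] := sum_color_costP G (sum_color_cost G);
  exact: painter_lister_le.
Qed.

Lemma sum_color_cost_ge G k :
  lister_guarantees [set: G] k -> k <= sum_color_cost G.
Proof.
by move=> lk; have [_ /(_ erefl)[pk _]] := sum_color_costP G (sum_color_cost G);
  exact: painter_lister_le lk.
Qed.

Lemma painter_guarantees_leq G (A : {set G}) j k :
  painter_guarantees A j -> j <= k -> painter_guarantees A k.
Proof.
move=> pA; elim: pA k => {A j} [j|A j reply bnd legal _ IH] k jk.
  exact: PainterEnd.
apply: (@PainterRound _ _ _ reply) => // M hM.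
  exact: leq_trans (bnd M hM) jk.
exact/IH/leq_sub2r.
Qed.

(** A single round with a relational reply: choice turns it into the reply
    function of a strategy, and the bound on the score needs no truncated
    subtraction. *)
Lemma painter_round G (A : {set G}) k :
  (forall M, lister_move A M -> exists I j,
     [/\ painter_move M I, painter_guarantees (A :\: I) j & #|M| + j <= k]) ->
  painter_guarantees A k.
Proof.
move=> answer.
have /choice[reply replyP] M : exists I, lister_move A M -> exists j,
    [/\ painter_move M I, painter_guarantees (A :\: I) j & #|M| + j <= k].
  have [/answer[I [j h]]|_] := boolP (lister_move A M); last by exists set0.
  by exists I => _; exists j.
apply: (@PainterRound _ _ _ reply) => M /replyP[j [legal pj jk]] //.
  exact: leq_trans (leq_addr _ _) jk.
apply: painter_guarantees_leq pj _.
by rewrite leq_subRL ?(leq_trans (leq_addr _ _) jk).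
Qed.

Lemma lister_guarantees_leq G (A : {set G}) j k :
  lister_guarantees A k -> j <= k -> lister_guarantees A j.
Proof.
move=> lA; elim: lA j => {A k} [A|A k M hM _ IH] j jk.
  by move: jk; rewrite leqn0 => /eqP->; exact: ListerEnd.
by apply: (ListerRound hM) => I hI; apply: IH hI _ (leq_sub2r _ jk).
Qed.

(** Lister can play as if the vertices outside A were absent. *)
Lemma lister_guaranteesS G (A B : {set G}) k :
  A \subset B -> lister_guarantees A k -> lister_guarantees B k.
Proof.
move=> AB lA; elim: lA B AB => {A k} [A|A k M /andP[M0 MA] _ IH] B AB.
  exact: ListerEnd.
apply: (@ListerRound _ _ _ M); first by rewrite /lister_move M0 (subset_trans MA).
by move=> I hI; apply: IH hI _ (setSD _ AB).
Qed.

(** Marking everything once is enough. *)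
Lemma lister_guarantees_card G (A : {set G}) : lister_guarantees A #|A|.
Proof.
have [->|A0] := eqVneq A set0; first by rewrite cards0; exact: ListerEnd.
apply: (@ListerRound _ _ _ A); first by rewrite /lister_move A0 subxx.
by move=> I _; rewrite subnn; exact: ListerEnd.
Qed.

(** Lister plays on A until its target is met, and then on B: as long as the
    marks lie inside A, B stays untouched. *)
Lemma lister_guaranteesU G (A B : {set G}) j k :
  [disjoint A & B] -> lister_guarantees A j -> lister_guarantees B k ->
  lister_guarantees (A :|: B) (j + k).
Proof.
move=> dAB lA lB; elim: lA dAB => {A j} [A|A j M hM _ IH] dAB.
  exact: lister_guaranteesS (subsetUr _ _) lB.
have /andP[M0 MA] := hM.
apply: (@ListerRound _ _ _ M).
  by rewrite /lister_move M0 (subset_trans MA) ?subsetUl.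
move=> I hI; have dIB : B :\: I = B.
  apply/setDidPl; rewrite disjoint_sym; apply: disjointWl dAB.
  by case/andP: hI => /subset_trans->.
have dAIB : [disjoint A :\: I & B] := disjointWl (subsetDl _ _) dAB.
have := IH I hI dAIB; rewrite setDUl dIB => /lister_guarantees_leq; apply.
by lia.
Qed.

Lemma lister_round G (A M : {set G}) k : M != set0 -> M \subset A ->
  (forall I : {set G}, I \subset M -> independent I ->
     exists2 j, lister_guarantees (A :\: I) j & k <= #|M| + j) ->
  lister_guarantees A k.
Proof.
move=> M0 MA lA; apply: (@ListerRound _ _ _ M); first by rewrite /lister_move M0.
move=> I /andP[IM indI]; have [j lj kj] := lA I IM indI.
by apply: lister_guarantees_leq lj _; rewrite leq_subLR.
Qed.

Lemma independentP G (I : {set G}) :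
  reflect {in I &, forall x y, ~~ edge x y} (independent I).
Proof.
apply: (iffP 'forall_in_forall_inP) => indI x; first by move=> y xI; exact: indI.
by move=> xI y; exact: indI.
Qed.

Lemma independentS G (I J : {set G}) :
  I \subset J -> independent J -> independent I.
Proof.
move=> /subsetP IJ /independentP indJ; apply/independentP => x y xI yI.
by apply: indJ; exact: IJ.
Qed.

Lemma independent0 G : independent (set0 : {set G}).
Proof. by apply/independentP => x y; rewrite inE. Qed.

Lemma independent1 G (x : G) : independent [set x].
Proof. by apply/independentP => y z /set1P-> /set1P->; rewrite edge_irrefl. Qed.

Lemma painter_guarantees_independent G (A : {set G}) :
  independent A -> painter_guarantees A #|A|.
Proof.
move: {2}(#|A|) (leqnn #|A|) => n; elim: n A => [|n IH] A An indA.
  by move: An; rewrite leqn0 cards_eq0 => /eqP->; exact: PainterEnd.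
apply: painter_round => M /andP[M0 MA]; exists M, #|A :\: M|.
have M_gt0 : 0 < #|M| by rewrite card_gt0.
have cA := cardsID M A; rewrite (setIidPr MA) in cA.
rewrite cA leqnn; split=> //.
  by rewrite /painter_move subxx (independentS MA indA).
by apply: IH; [lia | exact: independentS (subsetDl _ _) indA].
Qed.

(** * Lister on connected sets *)

Lemma disjoint_setP (T : finType) (A B : {set T}) :
  reflect (forall x, x \in A -> x \notin B) [disjoint A & B].
Proof. by rewrite disjoint_subset; exact: subsetP. Qed.

Lemma cardsU_disjoint (T : finType) (A B : {set T}) :
  [disjoint A & B] -> #|A :|: B| = #|A| + #|B|.
Proof. by move=> dAB; apply/eqP; rewrite (leq_card_setU A B). Qed.

(** Lister marks the centre c with a set K of k leaves, k being the triangular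
    root of the number of leaves.  If Painter takes c, all leaves are
    left; otherwise at least the star on the leaves outside K is. *)
Lemma lister_guarantees_star G (c : G) (L : {set G}) :
  c \notin L -> {in L, forall x, edge c x} ->
  lister_guarantees (c |: L) (#|L|.+1 + triangular_root #|L|).
Proof.
move: {2}(#|L|) (leqnn #|L|) => n; elim: n L => [|n IH] L Ln cL adj.
  have -> : #|L| = 0 by lia.
  rewrite triangular_root0 addn0.
  apply: (lister_guaranteesS (subsetUl [set c] L)).
  by rewrite -(cards1 c); exact: lister_guarantees_card.
have [L0|L_gt0] := posnP #|L|; first by apply: IH; rewrite ?L0.
set k := triangular_root #|L|.
have k_gt0 : 0 < k by rewrite leq_triangular_root; lia.
have kL : k <= #|L| by have := triangular_root_bounds #|L|; rewrite -/k; nia.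
have [K KL cardK] : exists2 K : {set G}, K \subset L & #|K| = k.
  have /card_geqP[s [uniq_s size_s sL]] := kL.
  exists [set x in s]; first by apply/subsetP => x; rewrite inE => /sL.
  by rewrite cardsE (card_uniqP uniq_s).
have cK : c \notin K by apply: contra cL; exact: (subsetP KL).
have cardM : #|c |: K| = k.+1 by rewrite cardsU1 cK cardK.
apply: (@lister_round _ _ (c |: K)).
- by rewrite -card_gt0 cardM.
- exact: setUS.
move=> I /subsetP IM /independentP indI; rewrite cardM.
have [cI|cI] := boolP (c \in I).
  (* Having colored the centre, Painter has colored nothing else. *)
  exists #|L|; last by lia.
  apply: (lister_guaranteesS _ (lister_guarantees_card L)).
  apply/subsetP => x xL; rewrite !inE xL orbT andbT.
  by apply: contraTN (adj x xL) => xI; exact: indI.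
exists (#|L :\: K|.+1 + triangular_root #|L :\: K|); last first.
  have := triangular_root_drop L_gt0; rewrite -/k.
  by have := cardsID K L; rewrite (setIidPr KL) cardK => <-; rewrite addKn; lia.
(* Coloring only part of K leaves even more than the star on the rest. *)
apply: (@lister_guaranteesS _ (c |: (L :\: K))).
  apply/subsetP => x; rewrite !inE => /predU1P[->|/andP[xK ->]].
    by rewrite eqxx cI.
  rewrite orbT andbT; apply: contra xK => xI; move: (IM x xI).
  by rewrite !inE => /predU1P[xc|//]; rewrite -xc xI in cI.
apply: IH.
- by have := cardsID K L; rewrite (setIidPr KL) cardK; lia.
- by rewrite inE negb_and cL orbT.
- by move=> x /setDP[xL _]; exact: adj.
Qed.

(** Vertex sets inducing a connected subgraph, in the form of a growth process
    that adds one vertex at a time next to an earlier one. *)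
Inductive connected_set G : {set G} -> Prop :=
| Connected1 x : connected_set [set x]
| ConnectedU1 A x y : connected_set A -> x \in A -> y \notin A -> edge x y ->
    connected_set (y |: A).

Lemma connected_set_star G (c : G) (L : {set G}) :
  c \notin L -> {in L, forall x, edge c x} -> connected_set (c |: L).
Proof.
move: {2}(#|L|) (erefl #|L|) => n; elim: n L => [|n IH] L Ln cL adj.
  by move/eqP: Ln; rewrite cards_eq0 => /eqP->; rewrite setU0; exact: Connected1.
have /card_gt0P[x xL] : 0 < #|L| by rewrite Ln.
rewrite -(setD1K xL) setUCA; apply: (@ConnectedU1 _ _ c).
- apply: IH; first by move: Ln; rewrite (cardsD1 x) xL => -[].
    by rewrite inE negb_and cL orbT.
  by move=> y /setD1P[_]; exact: adj.
- exact: setU11.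
- by rewrite !inE eqxx /= orbF; apply: contraNneq cL => <-.
- exact: adj.
Qed.

(** Follow the growth of A.  A split survives the arrival of a new vertex, which
    joins the part of its neighbor x.  A star survives if x is the centre, or if
    the star is a single edge, which may be centred at x instead; otherwise the
    edge from x to the new vertex splits off from the star on the rest. *)
Lemma star_or_split G (A : {set G}) : connected_set A ->
  (exists c (L : {set G}),
     [/\ A = c |: L, c \notin L & {in L, forall x, edge c x}]) \/
  (exists B C : {set G}, [/\ connected_set B, connected_set C,
     A = B :|: C & [/\ [disjoint B & C], 1 < #|B| & 1 < #|C|]]).
Proof.
elim=> {A} [x|A x y cA IH xA yA xy].
  by left; exists x, set0; rewrite setU0 inE; split=> // y; rewrite inE.
case: IH => [[c [L [defA cL adj]]]|[B [C [cB cC defA [dBC B1 C1]]]]]; last first.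
  right; have cardU1 (D : {set G}) : 1 < #|D| -> 1 < #|y |: D|.
    by move/leq_trans; apply; apply: subset_leq_card; exact: subsetUr.
  have yBC : ((y \in B) = false) * ((y \in C) = false).
    by move: yA; rewrite defA inE negb_or => /andP[/negbTE-> /negbTE->].
  move: xA; rewrite defA inE => /orP[xB|xC].
  - exists (y |: B), C; split=> //.
    + by apply: ConnectedU1 xy; rewrite ?yBC.
    + by rewrite setUA.
    + split=> //; last exact: cardU1.
      apply/disjoint_setP => z /setU1P[->|]; first by rewrite yBC.
      exact/disjoint_setP.
  - exists B, (y |: C); split=> //.
    + by apply: ConnectedU1 xy; rewrite ?yBC.
    + by rewrite setUCA.
    + split=> //; last exact: cardU1.
      apply/disjoint_setP => z zB; rewrite !inE negb_or.
      have [zy|_] := eqVneq z y; first by rewrite zy yBC in zB.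
      by move/disjoint_setP: dBC; exact.
move: yA xA; rewrite defA !inE negb_or => /andP[yc yL] /predU1P[xc|xL].
  left; exists c, (y |: L); rewrite setUCA !inE negb_or eq_sym yc cL.
  by split=> // z /setU1P[->|/adj//]; rewrite -xc.
have xc : x != c by apply: contraNneq cL => <-.
have [L1|L1] := leqP #|L| 1.
  have -> : L = [set x].
    by apply/eqP; rewrite eq_sym eqEcard sub1set xL cards1.
  left; exists x, [set y; c]; rewrite !inE negb_or xc andbT; split=> //.
  - by rewrite setUA setUC.
  - by apply: contraNneq yL => <-.
  - by move=> z /set2P[]->; rewrite // edge_sym adj.
right; exists (c |: (L :\ x)), (y |: [set x]).
have cardL : #|L| = #|L :\ x|.+1 by rewrite (cardsD1 x) xL.
split.
- apply: connected_set_star; first by rewrite inE negb_and cL orbT.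
  by move=> z /setD1P[_]; exact: adj.
- apply: (@ConnectedU1 _ _ x) => //; first exact: Connected1.
    exact: set11.
  by rewrite inE; apply: contraNneq yL => ->.
- apply/setP => z; rewrite !inE.
  have [->|_] := eqVneq z x; rewrite ?xL ?orbT //=.
  by case: (z == c); case: (z == y); case: (z \in L).
- split.
  + apply/disjoint_setP => z; rewrite !inE negb_or.
    case/predU1P => [->|/andP[-> zL]]; first by rewrite eq_sym yc eq_sym xc.
    by rewrite andbT; apply: contraNneq yL => <-.
  + by rewrite cardsU1 inE negb_and cL orbT; lia.
  + rewrite cardsU1 inE cards1.
    by have -> : y != x by apply: contraNneq yL => ->.
Qed.

(** Splitting until only stars remain costs Lister nothing, because the triangular
    root is subadditive in the sense of [triangular_root_subadditive]. *)
Lemma lister_guarantees_connected G (A : {set G}) :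
  connected_set A -> lister_guarantees A (#|A| + triangular_root #|A|.-1).
Proof.
move: {2}(#|A|) (leqnn #|A|) => n; elim: n A => [|n IH] A An cA.
  have -> : #|A| = 0 by lia.
  by rewrite triangular_root0; exact: ListerEnd.
case: (star_or_split cA) => [[c [L [-> cL adj]]]|].
  by rewrite cardsU1 cL; exact: lister_guarantees_star.
case=> B [C [cB cC defA [dBC B1 C1]]].
have cardA : #|A| = #|B| + #|C| by rewrite defA cardsU_disjoint.
rewrite defA; apply: lister_guarantees_leq
  (lister_guaranteesU dBC (IH B _ cB) (IH C _ cC)) _; try lia.
rewrite -defA cardA.
have := @triangular_root_subadditive #|B|.-1 #|C|.-1.
have -> : (#|B|.-1 + #|C|.-1).+1 = (#|B| + #|C|).-1 by lia.
by lia.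
Qed.

Lemma connect_crossing G (A : {set G}) x y :
  connect (@edge G) x y -> x \in A -> y \notin A ->
  exists u v, [/\ u \in A, v \notin A & edge u v].
Proof.
case/connectP => p; elim: p x => [|z p IH] x /=; first by move=> _ -> ->.
move=> /andP[xz zp] lastp xA yA.
have [zA|zA] := boolP (z \in A); first exact: IH zp lastp zA yA.
by exists x, z.
Qed.

(** Connectedness by walks yields the growth process: as long as A is not
    everything, a walk from A to a missing vertex leaves A along an edge. *)
Lemma connected_setT G :
  0 < #|G| -> graph_connected G -> connected_set [set: G].
Proof.
case/card_gt0P => x _ conG.
suff grow n (A : {set G}) :
    #|~: A| = n -> connected_set A -> connected_set [set: G].
  by apply: grow erefl (Connected1 x).
elim: n A => [|n IH] A cardA cA.
  have /eqP<- // : A == [set: G].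
  by rewrite eqEcard subsetT cardsT -(cardsC A) cardA addn0 leqnn.
have [z zA] : exists z, z \in A.
  case: (cA) => [a|B a b _ _ _ _]; first by exists a; rewrite inE.
  by exists b; rewrite setU11.
have /card_gt0P[y] : 0 < #|~: A| by rewrite cardA.
rewrite inE => yA; have [u [v [uA vA uv]]] := connect_crossing (conG z y) zA yA.
apply: (IH (v |: A)); last exact: ConnectedU1 uv.
have := cardsC A; have := cardsC (v |: A); rewrite cardsU1 vA; lia.
Qed.

(** * Painter on stars *)

(** If Painter answers with all marked leaves K, the new target is smaller by
    the drop of the triangular root.  That pays for the marked centre as soon as
    K has more elements than the triangular root of #|L|; for smaller K,
    coloring the centre is affordable. *)
Lemma painter_guarantees_star G (c : G) (L : {set G}) :
  c \notin L -> independent L ->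
  painter_guarantees (c |: L) (#|L|.+1 + triangular_root #|L|).
Proof.
move: {2}(#|L|) (leqnn #|L|) => n; elim: n L => [|n IH] L Ln cL indL.
  have /eqP -> : L == set0 by rewrite -cards_eq0; lia.
  rewrite setU0 cards0 triangular_root0 addn0 -(cards1 c).
  exact/painter_guarantees_independent/independent1.
apply: painter_round => M /andP[M0 /subsetP MA].
set K := M :\ c; have KL : K \subset L.
  by apply/subsetP => x /setD1P[xc /MA]; rewrite inE in_set1 (negbTE xc).
have cardK := cardsID K L; rewrite (setIidPr KL) in cardK.
have cardM : #|M| = (c \in M) + #|K| by exact: cardsD1.
have leaf_reply : 0 < #|K| ->
    (c \in M) + triangular_root #|L :\: K| <= triangular_root #|L| ->
    exists I j, [/\ painter_move M I, painter_guarantees ((c |: L) :\: I) j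
      & #|M| + j <= #|L|.+1 + triangular_root #|L|].
  move=> K_gt0 le; exists K, (#|L :\: K|.+1 + triangular_root #|L :\: K|); split.
  - by rewrite /painter_move subsetDl (independentS KL).
  - have -> : (c |: L) :\: K = c |: (L :\: K).
      rewrite setDUl; congr setU; apply/setDidPl/disjoint_setP => x /set1P->.
      by rewrite !inE eqxx.
    apply: IH; first by lia.
      by rewrite inE negb_and cL orbT.
    exact: independentS (subsetDl _ _) indL.
  - by rewrite cardM; lia.
have [cM|cM] := boolP (c \in M); last first.
  apply: leaf_reply; first by move: M0; rewrite -card_gt0 cardM (negbTE cM).
  by rewrite (negbTE cM); apply: triangular_root_homo; lia.
have [small|big] := leqP #|K| (triangular_root #|L|).
  exists [set c], #|L|; split; last by rewrite cardM cM; lia.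
    by rewrite /painter_move sub1set cM independent1.
  by rewrite setU1K //; exact: painter_guarantees_independent.
apply: leaf_reply; first by lia.
rewrite cM; have -> : #|L :\: K| = #|L| - #|K| by lia.
by apply: triangular_root_drop_lt; rewrite // -cardK leq_addr.
Qed.

(** * Rooted trees and forests *)

Definition apart G (A B : {set G}) : Prop :=
  [disjoint A & B] /\ {in A & B, forall x y, ~~ edge x y}.

Definition joined G (r s : G) (A B : {set G}) : Prop :=
  [disjoint A & B] /\ {in A & B, forall x y, edge x y -> x = r /\ y = s}.

(** Building trees by joining two rooted trees along an edge between their roots
    makes it possible to combine Painter's replies on the two pieces. *)
Inductive rooted_tree G : G -> {set G} -> Prop :=
| RootedTree1 r : rooted_tree r [set r]
| RootedTreeU r s A B : rooted_tree r A -> rooted_tree s B ->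
    edge r s -> joined r s A B -> rooted_tree r (A :|: B).

(** [odd_forest A j]: the subgraph induced by A is a forest, and j of its
    components have odd order. *)
Inductive odd_forest G : {set G} -> nat -> Prop :=
| OddForest0 : odd_forest set0 0
| OddForestU r A B j : rooted_tree r A -> odd_forest B j -> apart A B ->
    odd_forest (A :|: B) (odd #|A| + j).

(** Here K is the component of r, and j leaves K out of the count: K may still
    be joined to another tree, which can change its parity. *)
Definition rooted_forest G (r : G) (A : {set G}) (j : nat) : Prop :=
  exists K B : {set G},
    [/\ rooted_tree r K, odd_forest B j, apart K B & A = K :|: B].

Lemma apartW G (A A' B B' : {set G}) :
  A' \subset A -> B' \subset B -> apart A B -> apart A' B'.
Proof.
move=> /subsetP AA /subsetP BB [dAB eAB]; split.
  by apply: disjointW dAB; apply/subsetP.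
by move=> x y /AA xA /BB; exact: eAB.
Qed.

Lemma apartC G (A B : {set G}) : apart A B -> apart B A.
Proof.
move=> [dAB eAB]; split; first by rewrite disjoint_sym.
by move=> x y xB yA; rewrite edge_sym; exact: eAB.
Qed.

Lemma apartUl G (A B C : {set G}) : apart A C -> apart B C -> apart (A :|: B) C.
Proof.
move=> [/disjoint_setP dA eA] [/disjoint_setP dB eB]; split.
  by apply/disjoint_setP => x /setUP[]; [exact: dA | exact: dB].
by move=> x y /setUP[xA|xB]; [exact: eA | exact: eB].
Qed.

Lemma apartUr G (A B C : {set G}) : apart A B -> apart A C -> apart A (B :|: C).
Proof. by move=> /apartC aBA /apartC aCA; apply/apartC/apartUl. Qed.

Lemma joinedW G (r s : G) (A A' B B' : {set G}) :
  A' \subset A -> B' \subset B -> joined r s A B -> joined r s A' B'.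
Proof.
move=> /subsetP AA /subsetP BB [dAB eAB]; split.
  by apply: disjointW dAB; apply/subsetP.
by move=> x y /AA xA /BB; exact: eAB.
Qed.

Lemma joined_apart G (r s : G) (A B : {set G}) :
  joined r s A B -> (r \notin A) || (s \notin B) -> apart A B.
Proof.
move=> [dAB eAB] nrs; split=> // x y xA yB; apply: contraL nrs => xy.
by have [<- <-] := eAB _ _ xA yB xy; rewrite xA yB.
Qed.

Lemma rooted_tree_root G (r : G) A : rooted_tree r A -> r \in A.
Proof. by elim=> {r A} [r|r s A B _ rA *]; rewrite inE ?rA. Qed.

Lemma rooted_forest_root G (r : G) A j : rooted_forest r A j -> r \in A.
Proof. by move=> [K [B [/rooted_tree_root rK _ _ ->]]]; rewrite inE rK. Qed.

(** This congruence is what improves inequalities by one later on. *)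
Lemma odd_forest_parity G (A : {set G}) j : odd_forest A j -> odd j = odd #|A|.
Proof.
elim=> {A j} [|r A B j _ _ IH [dAB _]]; first by rewrite cards0.
by rewrite cardsU_disjoint // !oddD IH oddb.
Qed.

Lemma odd_forest_leq_card G (A : {set G}) j : odd_forest A j -> j <= #|A|.
Proof.
elim=> {A j} [|r A B j rA _ IH [dAB _]] //.
rewrite cardsU_disjoint // leq_add //; case: odd => //.
by apply/card_gt0P; exists r; exact: rooted_tree_root rA.
Qed.

Lemma odd_forestU G (A B : {set G}) i j :
  odd_forest A i -> odd_forest B j -> apart A B -> odd_forest (A :|: B) (i + j).
Proof.
move=> fA fB; elim: fA => {A i} [|r A C i rA _ IH aAC] aAB.
  by rewrite set0U.
rewrite -setUA -addnA; apply: OddForestU rA _ _.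
  by apply/IH/(apartW _ _ aAB); rewrite ?subsetUr.
by apply: apartUr => //; apply: apartW aAB; rewrite ?subsetUl.
Qed.

Lemma rooted_forest_close G (r : G) A j :
  rooted_forest r A j -> exists2 j', j <= j' & odd_forest A j'.
Proof.
move=> [K [B [rK fB aKB ->]]]; exists (odd #|K| + j); first exact: leq_addl.
exact: OddForestU rK fB aKB.
Qed.

Lemma rooted_forest_union_forest G (r : G) (A B : {set G}) i j :
  rooted_forest r A i -> odd_forest B j -> apart A B ->
  rooted_forest r (A :|: B) (i + j).
Proof.
move=> [K [C [rK fC aKC ->]]] fB aAB; exists K, (C :|: B); rewrite setUA.
split=> //.
  by apply: odd_forestU fC fB _; apply: apartW aAB; rewrite ?subsetUr.
by apply: apartUr => //; apply: apartW aAB; rewrite ?subsetUl.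
Qed.

Lemma rooted_forest_union G (r s : G) (A B : {set G}) i j :
  rooted_forest r A i -> rooted_forest s B j -> edge r s -> joined r s A B ->
  rooted_forest r (A :|: B) (i + j).
Proof.
move=> [K [C [rK fC aKC ->]]] [L [D [sL fD aLD ->]]] rs jAB.
have rC : r \notin C.
  by case: aKC => /disjoint_setP dKC _; exact/dKC/rooted_tree_root.
have sD : s \notin D.
  by case: aLD => /disjoint_setP dLD _; exact/dLD/rooted_tree_root.
have jsub (A' B' : {set G}) :
    A' \subset K :|: C -> B' \subset L :|: D -> joined r s A' B'.
  by move=> AA BB; exact: joinedW jAB.
exists (K :|: L), (C :|: D); split; last by rewrite setUACA.
- by apply: RootedTreeU rK sL rs _; apply: jsub; exact: subsetUl.
- apply: odd_forestU fC fD _; apply: (@joined_apart _ r s); last by rewrite rC.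
  by apply: jsub; exact: subsetUr.
- apply: apartUl; apply: apartUr => //.
    apply: (@joined_apart _ r s); last by rewrite sD orbT.
    by apply: jsub; [exact: subsetUl | exact: subsetUr].
  apply/apartC/(@joined_apart _ r s); last by rewrite rC.
  by apply: jsub; [exact: subsetUr | exact: subsetUl].
Qed.

(** * Painter's replies on forests *)

(** A reply I to the marked set M on a tree A.  In a closed reply all odd
    components of what remains are counted; in an open reply the root r stays
    uncolored and its component is not counted. *)
Definition closed_reply G (A M I : {set G}) (j : nat) : Prop :=
  [/\ I \subset A :&: M, independent I & odd_forest (A :\: I) j].

Definition open_reply G (r : G) (A M I : {set G}) (j : nat) : Prop :=
  [/\ I \subset A :&: M, independent I & rooted_forest r (A :\: I) j].

Lemma reply_set_union G (A B M I J : {set G}) : [disjoint A & B] ->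
  I \subset A :&: M -> J \subset B :&: M ->
  [/\ I :|: J \subset (A :|: B) :&: M,
      (A :|: B) :\: (I :|: J) = (A :\: I) :|: (B :\: J)
    & #|I :|: J| = #|I| + #|J|].
Proof.
move=> /disjoint_setP dAB /subsetP IA /subsetP JB; split.
- by rewrite setIUl setUSS //; exact/subsetP.
- apply/setP => x; rewrite !inE.
  move: (dAB x) (IA x) (JB x); rewrite !inE.
  case: (x \in A); case: (x \in B); case: (x \in I); case: (x \in J) => //=;
    by move=> h1 h2 h3; by [have := h1 isT | have := h2 isT | have := h3 isT].
- apply: cardsU_disjoint; apply/disjoint_setP => x xI.
  by apply: contra (dAB x _) => [/JB/setIP[]|] //; case/setIP: (IA x xI).
Qed.

Lemma independentU G (r s : G) (I J A B : {set G}) :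
  joined r s A B -> I \subset A -> J \subset B -> (r \notin I) || (s \notin J) ->
  independent I -> independent J -> independent (I :|: J).
Proof.
move=> jAB IA JB nrs /independentP indI /independentP indJ.
have [_ aIJ] := joined_apart (joinedW IA JB jAB) nrs.
apply/independentP => x y /setUP[xI|xJ] /setUP[yI|yJ].
- exact: indI.
- exact: aIJ.
- by rewrite edge_sym aIJ.
- exact: indJ.
Qed.

Lemma closed_reply_sub G (A M I : {set G}) j :
  closed_reply A M I j -> I \subset A :&: M.
Proof. by case. Qed.

Lemma open_reply_sub G (r : G) (A M I : {set G}) j :
  open_reply r A M I j -> I \subset A :&: M.
Proof. by case. Qed.

Lemma open_reply_root G (r : G) A M I j : open_reply r A M I j -> r \notin I.
Proof. by case=> _ _ /rooted_forest_root/setDP[]. Qed.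

Lemma open_reply_close G (r : G) A M I j :
  open_reply r A M I j -> exists2 j', j <= j' & closed_reply A M I j'.
Proof.
by case=> IA indI /rooted_forest_close[j' jj' f]; exists j'.
Qed.

Lemma closed_reply_parity G (A M I : {set G}) j :
  closed_reply A M I j -> odd (3 * #|I| + j) = odd #|A|.
Proof.
case=> IA _ /odd_forest_parity; rewrite oddD oddM /= => ->.
have := cardsID I A; rewrite (setIidPr (subset_trans IA (subsetIl _ _))) => <-.
by rewrite oddD.
Qed.

(** Replies I on A and J on B combine unless r is in I and s is in J.  If r and s both stay uncolored their components merge; if one of
    them is colored, nothing joins the remainders. *)
Lemma open_open_reply G (r s : G) (A B M I J : {set G}) i j :
  edge r s -> joined r s A B -> open_reply r A M I i -> open_reply s B M J j ->
  open_reply r (A :|: B) M (I :|: J) (i + j).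
Proof.
move=> rs jAB oA oB; have rI := open_reply_root oA.
case: oA oB => IA indI fA [JB indJ fB].
have [sub eqD _] := reply_set_union (proj1 jAB) IA JB; split=> //.
  apply: independentU jAB _ _ _ indI indJ; rewrite ?rI //.
    exact: subset_trans IA (subsetIl _ _).
  exact: subset_trans JB (subsetIl _ _).
rewrite eqD; apply: rooted_forest_union fA fB rs _.
exact: joinedW (subsetDl _ _) (subsetDl _ _) jAB.
Qed.

Lemma open_closed_reply G (r s : G) (A B M I J : {set G}) i j :
  joined r s A B -> open_reply r A M I i -> closed_reply B M J j -> s \in J ->
  open_reply r (A :|: B) M (I :|: J) (i + j).
Proof.
move=> jAB oA cB sJ; have rI := open_reply_root oA.
case: oA cB => IA indI fA [JB indJ fB].
have [sub eqD _] := reply_set_union (proj1 jAB) IA JB; split=> //.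
  apply: independentU jAB _ _ _ indI indJ; rewrite ?rI //.
    exact: subset_trans IA (subsetIl _ _).
  exact: subset_trans JB (subsetIl _ _).
rewrite eqD; apply: rooted_forest_union_forest fA fB _.
apply: (@joined_apart _ r s); last by rewrite !inE sJ orbT.
exact: joinedW (subsetDl _ _) (subsetDl _ _) jAB.
Qed.

Lemma closed_closed_reply G (r s : G) (A B M I J : {set G}) i j :
  joined r s A B -> closed_reply A M I i -> closed_reply B M J j ->
  r \in I -> s \notin J -> closed_reply (A :|: B) M (I :|: J) (i + j).
Proof.
move=> jAB [IA indI fA] [JB indJ fB] rI sJ.
have [sub eqD _] := reply_set_union (proj1 jAB) IA JB; split=> //.
  apply: independentU jAB _ _ _ indI indJ; rewrite ?sJ ?orbT //.
    exact: subset_trans IA (subsetIl _ _).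
  exact: subset_trans JB (subsetIl _ _).
rewrite eqD; apply: odd_forestU fA fB _.
apply: (@joined_apart _ r s); last by rewrite !inE rI.
exact: joinedW (subsetDl _ _) (subsetDl _ _) jAB.
Qed.

Lemma card_reply_union G (r s : G) (A B M I J : {set G}) :
  joined r s A B -> I \subset A :&: M -> J \subset B :&: M ->
  #|I :|: J| = #|I| + #|J|.
Proof. by move=> [dAB _] IA JB; have [] := reply_set_union dAB IA JB. Qed.

(** Induction on the way the tree is built.  For a marked root, coloring r forces
    a marked s to stay uncolored, and the other reply may color s; so the
    colored reply on one side is paired with the uncolored one on the other.
    Both replies on B are then used exactly once and only their sum
    matters.  The error term 1 does not accumulate: when the open reply on B is
    closed, both replies on B are closed, and parity makes the error vanish. *)
Lemma rooted_tree_reply G (r : G) (A M : {set G}) : rooted_tree r A ->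
  (r \notin M -> exists I j,
     open_reply r A M I j /\ 2 * #|A :&: M| <= 3 * #|I| + j) /\
  (r \in M -> exists (I : {set G}) (i : nat) (J : {set G}) (j : nat),
     [/\ r \in I, closed_reply A M I i, open_reply r A M J j
       & 4 * #|A :&: M| <= (3 * #|I| + i) + (3 * #|J| + j) + 1]).
Proof.
elim=> {r A} [r|r s A B _ [IHA0 IHA1] _ [IHB0 IHB1] rs jAB].
  have open0 : open_reply r [set r] M set0 0.
    split; [exact: sub0set | exact: independent0 | exists [set r], set0].
    rewrite setD0 setU0; split=> //; [exact: RootedTree1 | exact: OddForest0 |].
    by split=> [|x y _]; [apply/disjoint_setP => x; rewrite !inE | rewrite inE].
  split=> rM.
    exists set0, 0; split=> //; rewrite (_ : _ :&: M = set0) ?cards0 //.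
    by apply/eqP; rewrite setI_eq0; apply/disjoint_setP => x /set1P->.
  have rrM : [set r] :&: M = [set r] by apply/setIidPl; rewrite sub1set.
  exists [set r], 0, set0, 0; rewrite /closed_reply rrM cards1 cards0 set11 setDv.
  split=> //; split=> //; [exact: independent1 | exact: OddForest0].
have cardM : #|(A :|: B) :&: M| = #|A :&: M| + #|B :&: M|.
  rewrite setIUl cardsU_disjoint //; case: jAB => dAB _.
  by apply: disjointW dAB; exact: subsetIl.
have [sM|sM] := boolP (s \in M).
  have [I' [i' [J' [j' [sI' cI' oJ' leB]]]]] := IHB1 sM.
  have [j'' jj'' cJ'] := open_reply_close oJ'.
  (* Both summands on the right are congruent to #|B| modulo 2. *)
  have leB' : 4 * #|B :&: M| <= (3 * #|I'| + i') + (3 * #|J'| + j'').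
    by have := closed_reply_parity cI'; have := closed_reply_parity cJ'; lia.
  split=> rM.
    have [I [i [oI leA]]] := IHA0 rM.
    (* One of two integers with sum at least -1 is nonnegative. *)
    have [good|bad] := leqP (2 * #|B :&: M|) (3 * #|I'| + i').
      exists (I :|: I'), (i + i').
      split; first exact: open_closed_reply oI cI' sI'.
      rewrite (card_reply_union jAB (open_reply_sub oI) (closed_reply_sub cI')).
      by lia.
    exists (I :|: J'), (i + j'); split; first exact: open_open_reply oI oJ'.
    rewrite (card_reply_union jAB (open_reply_sub oI) (open_reply_sub oJ')).
    by lia.
  have [I [i [J [j [rI cI oJ leA]]]]] := IHA1 rM.
  exists (I :|: J'), (i + j''), (J :|: I'), (j + i'); split.
  - by rewrite inE rI.
  - exact: closed_closed_reply cI cJ' rI (open_reply_root oJ').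
  - exact: open_closed_reply oJ cI' sI'.
  - rewrite (card_reply_union jAB (closed_reply_sub cI) (open_reply_sub oJ'))
      (card_reply_union jAB (open_reply_sub oJ) (closed_reply_sub cI')).
    by lia.
have [H [h [oH leB]]] := IHB0 sM; split=> rM.
  have [I [i [oI leA]]] := IHA0 rM.
  exists (I :|: H), (i + h); split; first exact: open_open_reply oI oH.
  rewrite (card_reply_union jAB (open_reply_sub oI) (open_reply_sub oH)).
  by lia.
have [I [i [J [j [rI cI oJ leA]]]]] := IHA1 rM.
have [h' hh' cH] := open_reply_close oH.
exists (I :|: H), (i + h'), (J :|: H), (j + h); split.
- by rewrite inE rI.
- exact: closed_closed_reply cI cH rI (open_reply_root oH).
- exact: open_open_reply oJ oH.
- rewrite (card_reply_union jAB (closed_reply_sub cI) (open_reply_sub oH))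
    (card_reply_union jAB (open_reply_sub oJ) (open_reply_sub oH)).
  by lia.
Qed.

Lemma rooted_tree_closed_reply G (r : G) (A M : {set G}) : rooted_tree r A ->
  exists I j, closed_reply A M I j /\
    2 * #|A :&: M| + odd #|A| <= 3 * #|I| + j.
Proof.
move=> tA; have [unmarked marked] := rooted_tree_reply M tA.
suff [I [j [c le]]] : exists I j, closed_reply A M I j /\
    2 * #|A :&: M| <= 3 * #|I| + j.
  by exists I, j; split=> //; have := closed_reply_parity c; lia.
have [rM|rM] := boolP (r \in M); last first.
  have [I [j [oI le]]] := unmarked rM; have [j' jj' c] := open_reply_close oI.
  by exists I, j'; split=> //; lia.
have [I [i [J [j [_ cI oJ le]]]]] := marked rM.
have [j' jj' cJ] := open_reply_close oJ.
have [good|bad] := leqP (2 * #|A :&: M|) (3 * #|I| + i); first by exists I, i.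
by exists J, j'; split=> //; lia.
Qed.

Lemma odd_forest_reply G (A M : {set G}) j : odd_forest A j ->
  exists I i, closed_reply A M I i /\ 2 * #|A :&: M| + j <= 3 * #|I| + i.
Proof.
elim=> {A j} [|r A B j tA _ [J [j' [[JB indJ fB] leB]]] aAB].
  exists set0, 0; rewrite /closed_reply set0D set0I cards0.
  by split=> //; split; [exact: sub0set | exact: independent0 | exact: OddForest0].
have [I [i [[IA indI fA] leA]]] := rooted_tree_closed_reply M tA.
have [dAB eAB] := aAB; have [sub eqD cardIJ] := reply_set_union dAB IA JB.
exists (I :|: J), (i + j'); split; last first.
  rewrite cardIJ setIUl cardsU_disjoint; first by lia.
  by apply: disjointW dAB; exact: subsetIl.
split=> //; last first.
  rewrite eqD; apply: odd_forestU fA fB _.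
  exact: apartW (subsetDl _ _) (subsetDl _ _) aAB.
apply/independentP => x y /setUP[xI|xJ] /setUP[yI|yJ].
- by move/independentP: indI; apply.
- by apply: eAB; [case/setIP: (subsetP IA _ xI) | case/setIP: (subsetP JB _ yJ)].
- rewrite edge_sym.
  by apply: eAB; [case/setIP: (subsetP IA _ yI) | case/setIP: (subsetP JB _ xJ)].
- by move/independentP: indJ; apply.
Qed.

(** The potential (3 #|A| - j) / 2 bounds what Lister can still score: a round
    with marked set M and reply I lowers it by at least #|M|.  The induction is
    on the remaining budget k, since I may be empty. *)
Lemma painter_guarantees_forest G (A : {set G}) j k :
  odd_forest A j -> 3 * #|A| <= 2 * k + j -> painter_guarantees A k.
Proof.
elim/ltn_ind: k A j => k IH A j fA leA.
apply: painter_round => M /andP[M0 MA].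
have [I [i [[IA indI fI] le]]] := odd_forest_reply M fA.
move: IA le; rewrite (setIidPr MA) => IM le.
have M_gt0 : 0 < #|M| by rewrite card_gt0.
have MA_card := subset_leq_card MA.
have jA := odd_forest_leq_card fA.
have cardI := cardsID I A; rewrite (setIidPr (subset_trans IM MA)) in cardI.
exists I, (k - #|M|); split; [by rewrite /painter_move IM | | by lia].
by apply: IH fI _; lia.
Qed.

(** * Trees *)

(** The leaf joins the piece of its neighbor, down to a single vertex; so growing
    a tree by leaves can be turned into joining rooted trees at their roots. *)
Lemma rooted_tree_add_leaf G (r x y : G) (A : {set G}) :
  rooted_tree r A -> x \in A -> y \notin A -> edge x y ->
  {in A, forall z, edge z y -> z = x} -> rooted_tree r (y |: A).
Proof.
elim=> {r A} [r|r s A B tA IHA tB IHB rs [/disjoint_setP dAB eAB]].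
  move=> /set1P-> yr ry _; rewrite setUC.
  apply: RootedTreeU (RootedTree1 r) (RootedTree1 y) ry _.
  split; last by move=> u v /set1P-> /set1P->.
  by apply/disjoint_setP => u /set1P->; rewrite inE eq_sym -in_set1.
move=> xAB; rewrite inE negb_or => /andP[yA yB] xy unique.
case/setUP: xAB => [xA|xB].
  have tyA : rooted_tree r (y |: A).
    by apply: IHA => // z zA; apply: unique; rewrite inE zA.
  rewrite setUA; apply: RootedTreeU tyA tB rs _; split.
    by apply/disjoint_setP => z /setU1P[->|/dAB].
  move=> u v /setU1P[->|uA] vB uv; last exact: eAB.
  have vx : v = x by apply: unique; rewrite 1?edge_sym // inE vB orbT.
  by have := dAB x xA; rewrite -vx vB.
have tyB : rooted_tree s (y |: B).
  by apply: IHB => // z zB; apply: unique; rewrite inE zB orbT.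
rewrite setUCA; apply: RootedTreeU tA tyB rs _; split.
  apply/disjoint_setP => z zA; rewrite !inE negb_or dAB // andbT.
  by apply: contraNneq yA => <-.
move=> u v uA /setU1P[->|vB] uv; last exact: eAB.
have ux : u = x by apply: unique; rewrite // inE uA.
by have := dAB u uA; rewrite ux xB.
Qed.

Lemma connected_set_path G (A : {set G}) x y :
  connected_set A -> x \in A -> y \in A ->
  connect [rel u v | edge u v && (u \in A) && (v \in A)] x y.
Proof.
move=> cA; elim: cA x y => {A} [z|A x y cA IH xA yA xy] u v.
  by move=> /set1P-> /set1P->.
set e := [rel _ _ | _].
have e_sym : connect_sym e.
  apply: sym_connect_sym => a b /=.
  by rewrite edge_sym -!andbA [X in _ && X]andbC.
have inA a b : a \in A -> b \in A -> connect e a b.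
  move=> aA bA; apply: connect_sub (IH a b aA bA) => c d.
  move=> /= /andP[/andP[cd cA' dA]].
  by apply: connect1; rewrite /= cd !inE cA' dA !orbT.
have yP a : a \in A -> connect e a y.
  move=> aA; apply: connect_trans (inA a x aA xA) (connect1 _).
  by rewrite /= xy !inE xA eqxx orbT.
case/setU1P=> [->|uA] /setU1P[->|vA] //.
- by rewrite e_sym yP.
- exact: yP.
- exact: inA.
Qed.

(** Two neighbors x and z of y would close a cycle with a path from x to z inside
    A. *)
Lemma acyclic_unique_neighbor G (A : {set G}) x y z :
  graph_acyclic G -> connected_set A -> x \in A -> z \in A -> y \notin A ->
  edge x y -> edge z y -> z = x.
Proof.
move=> acG cA xA zA yA xy zy; apply/eqP/negPn/negP => zx.
have /connectP[p0 p0P p0z] := connected_set_path cA xA zA.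
case/shortenP: p0P p0z => p pP uniq_p _ lastp.
have pA : {subset x :: p <= A}.
  elim: p {uniq_p lastp xy zx} x xA pP => [|b p IH] a aA /=.
    by move=> _ c; rewrite inE => /eqP->.
  move=> /andP[/andP[_ bA] pP] c; rewrite inE => /predU1P[->//|].
  exact: IH bA pP c.
have: size (y :: x :: p) <= 2.
  apply: acG.
    by rewrite cons_uniq uniq_p andbT; apply: contra yA; exact: pA.
  rewrite /= rcons_path edge_sym xy -lastp zy andbT /=.
  by apply: sub_path pP => a b /= /andP[/andP[]].
case: p {pP uniq_p pA} lastp => // lastp.
by rewrite lastp eqxx in zx.
Qed.

Lemma acyclic_rooted_tree G (A : {set G}) :
  graph_acyclic G -> connected_set A -> exists r, rooted_tree r A.
Proof.
move=> acG; elim=> {A} [x|A x y cA [r tA] xA yA xy].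
  by exists x; exact: RootedTree1.
exists r; apply: (rooted_tree_add_leaf tA xA yA xy) => z zA zy.
exact: acyclic_unique_neighbor acG cA xA zA yA xy zy.
Qed.

Lemma sum_color_cost_tree_le n G :
  tree_on n G -> sum_color_cost G <= (3 * n) %/ 2.
Proof.
move=> [<- [G0 conG acG]]; apply: sum_color_cost_le.
have [r tG] := acyclic_rooted_tree acG (connected_setT G0 conG).
have apart0 : apart [set: G] set0.
  by split; [apply/disjoint_setP => x | move=> x y]; rewrite !inE.
have := OddForestU tG (OddForest0 G) apart0; rewrite setU0 => fG.
apply: painter_guarantees_forest fG _; rewrite cardsT.
by move: #|_| => m; lia.
Qed.

Lemma sum_color_cost_tree_ge n G :
  tree_on n G -> n + triangular_root n.-1 <= sum_color_cost G.
Proof.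
move=> [<- [G0 conG _]]; apply: sum_color_cost_ge.
by rewrite -cardsT; apply/lister_guarantees_connected/connected_setT.
Qed.

(** * Stars and paths *)

Lemma star_graph_tree n : 0 < n -> tree_on n (star_graph n).
Proof.
move=> n0; have cardS : #|star_graph n| = n by rewrite card_sum !card_ord; lia.
split=> //; split; first by rewrite cardS.
- have e_sym : connect_sym (@edge (star_graph n)).
    exact/sym_connect_sym/edge_sym.
  have centre x : connect (@edge (star_graph n)) (inl ord0) x.
    by case: x => x; [rewrite (ord1 x) | exact: connect1].
  by move=> x y; apply: connect_trans (centre y); rewrite e_sym.
- (* Every other vertex of a cycle would be the centre. *)
  move=> [|x [|y [|z c]]] //=.
  case: x => x; case: y => y //; case: z => z // uniq_c.
    by move: uniq_c; rewrite (ord1 x) (ord1 z) !inE eqxx !orbT.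
  case: c uniq_c => [|[w|w] c] //= uniq_c.
  by move: uniq_c; rewrite (ord1 y) (ord1 w) !inE eqxx !orbT !andbF.
Qed.

Lemma path_graph_tree n : 0 < n -> tree_on n (path_graph n).
Proof.
move=> n0; have cardP : #|path_graph n| = n by rewrite card_ord.
split=> //; split; first by rewrite cardP.
- have e_sym : connect_sym (@edge (path_graph n)).
    exact/sym_connect_sym/edge_sym.
  have from0 k (kn : k < n) :
      connect (@edge (path_graph n)) (Ordinal n0) (Ordinal kn).
    elim: k kn => [|k IH] kn; first by rewrite (bool_irrelevance kn n0).
    apply: connect_trans (IH (ltnW kn)) (connect1 _).
    by rewrite /= /path_edge eqxx.
  move=> [x xn] [y yn]; apply: connect_trans (from0 y yn).
  by rewrite e_sym.
- (* Both neighbors on a cycle of its largest vertex v would be v - 1. *)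
  move=> c uniq_c cycle_c; rewrite leqNgt; apply/negP => c3.
  have [v vc vmax] : exists2 v, v \in c & forall w, w \in c -> (w <= v)%N.
    case: c c3 {uniq_c cycle_c} => // v0 c _.
    exists [arg max_(v > v0 | v \in v0 :: c) (v : nat)];
      case: arg_maxnP => //; exact: mem_head.
  have [k c' rot_c] := rot_to vc.
  move: uniq_c cycle_c c3.
  rewrite -(rot_uniq k) -(rot_cycle k) -(size_rot k) rot_c.
  have {}vmax w : w \in v :: c' -> w <= v.
    by rewrite -rot_c mem_rot; exact: vmax.
  case: c' {rot_c} vmax => [|y [|z s]] // vmax uniq_c.
  rewrite /= rcons_path => /and4P[vy _ _ lastv] _.
  have lasts : last z s \in z :: s by exact: mem_last.
  have last_mem : last z s \in v :: y :: z :: s.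
    by rewrite !inE -in_cons lasts !orbT.
  have yv := vmax y; rewrite !inE eqxx orbT in yv.
  have lv := vmax _ last_mem.
  have yl : y = last z s :> nat.
    have below_max (a b : nat) :
        b <= a -> (a.+1 == b) || (b.+1 == a) -> b = a.-1 by lia.
    by rewrite (below_max v y) ?yv // (below_max v (last z s)) // orbC.
  move: uniq_c; rewrite /= => /and3P[_ yzs _].
  by rewrite (val_inj yl) lasts in yzs.
Qed.

Lemma lister_guarantees_edge G (x y : G) :
  edge x y -> lister_guarantees [set x; y] 3.
Proof.
move=> xy; have star := @lister_guarantees_star _ y [set x].
rewrite cards1 setUC in star; apply: lister_guarantees_leq (star _ _) _.
- by rewrite inE; apply: contraTneq xy => ->; rewrite edge_irrefl.
- by move=> z /set1P->; rewrite edge_sym.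
- have: 0 < triangular_root 1 by rewrite leq_triangular_root.
  by lia.
Qed.

(** Pair off the vertices along the path: each edge is worth 3 points and a
    vertex left over is worth 1. *)
Lemma lister_guarantees_path n m : m <= n ->
  lister_guarantees [set i : path_graph n | i < m] ((3 * m) %/ 2).
Proof.
elim/ltn_ind: m => -[|[|m]] IH mn; first exact: ListerEnd.
  apply: lister_guarantees_leq (lister_guarantees_card _) _.
  by apply/card_gt0P; exists (Ordinal mn); rewrite inE.
have m1 : m < n by lia.
set x : path_graph n := Ordinal m1; set y : path_graph n := Ordinal mn.
have xy : edge x y by rewrite /= /path_edge eqxx.
have eq_x (i : path_graph n) : (i == x) = ((i : nat) == m) by [].
have eq_y (i : path_graph n) : (i == y) = ((i : nat) == m.+1) by [].
have := lister_guaranteesU _ (IH m _ _) (lister_guarantees_edge xy).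
rewrite (_ : _ :|: (_ :|: _) = [set i : path_graph n | i < m.+2]); last first.
  apply/setP => i; rewrite !inE eq_x eq_y.
  by move: (nat_of_ord i) => k; lia.
rewrite (_ : 3 * m %/ 2 + 3 = 3 * m.+2 %/ 2); last by lia.
apply; try lia.
apply/disjoint_setP => i; rewrite !inE eq_x eq_y.
by move: (nat_of_ord i) => k; lia.
Qed.

Lemma sum_color_cost_path n : 0 < n ->
  sum_color_cost (path_graph n) = (3 * n) %/ 2.
Proof.
move=> n0; apply/eqP; rewrite eqn_leq.
rewrite sum_color_cost_tree_le; last exact: path_graph_tree.
apply: sum_color_cost_ge; have := lister_guarantees_path (leqnn n).
rewrite (_ : [set _ | _] = [set: path_graph n]) //.
by apply/setP => i; rewrite !inE ltn_ord.
Qed.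

Lemma sum_color_cost_star n : 0 < n ->
  sum_color_cost (star_graph n) = n + triangular_root n.-1.
Proof.
move=> n0; apply/eqP; rewrite eqn_leq.
rewrite sum_color_cost_tree_ge ?andbT; last exact: star_graph_tree.
apply: sum_color_cost_le.
pose c : star_graph n := inl ord0; pose L : {set star_graph n} := ~: [set c].
have cardL : #|L| = n.-1.
  by have := cardsC [set c]; rewrite cards1 -/L (star_graph_tree n0).1; lia.
have -> : [set: star_graph n] = c |: L by rewrite setUCr.
have -> : n + triangular_root n.-1 = #|L|.+1 + triangular_root #|L|.
  by rewrite cardL; lia.
apply: painter_guarantees_star; first by rewrite !inE eqxx.
by apply/independentP => -[x|x] [y|y] //; rewrite !inE ?(ord1 x) ?(ord1 y) eqxx.
Qed.
End SlowColoring.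

(** * The closed form and its asymptotics *)

Local Open Scope classical_set_scope.
Local Open Scope ring_scope.

Lemma triangular_root_real_bounds (R : realType) t :
  let r := (triangular_root t)%:R : R in
  r * (r + 1) <= 2 * t%:R < (r + 1) * (r + 2).
Proof.
have /andP[] := triangular_root_bounds t.
rewrite -(ler_nat R) -(ltr_nat R) -muln2 !natrM -!natr1 => le lt /=.
by apply/andP; split; lra.
Qed.

Lemma u_triangular_root (R : realType) t : u R t = (triangular_root t)%:Z.
Proof.
have /andP[] := triangular_root_real_bounds R t.
move: (triangular_root t) => k le lt.
have q_ge0 := sqrtr_ge0 (8 * t%:R + 1 : R).
have q2 : Num.sqrt (8 * t%:R + 1 : R) ^+ 2 = 8 * t%:R + 1.
  by rewrite sqr_sqrtr // addr_ge0 // mulr_ge0.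
have k_ge0 : 0 <= k%:R :> R by [].
apply: floor_def; rewrite intrD /=; rewrite -pmulrn.
move: q_ge0 q2; set q := Num.sqrt _ => q_ge0 q2.
have lo : 2 * k%:R + 1 <= q.
  by rewrite -ler_sqr ?nnegrE ?addr_ge0 ?mulr_ge0 // q2; nra.
have hi : q < 2 * k%:R + 3.
  by rewrite -ltr_sqr ?nnegrE ?addr_ge0 ?mulr_ge0 // q2; nra.
by apply/andP; split; lra.
Qed.

(** From r(r+1) <= 2(n-1) < (r+1)(r+2) follows r^2 <= 2n <= (r+2)^2. *)
Lemma triangular_root_sqrt (R : realType) n : (0 < n)%N ->
  `|(triangular_root n.-1)%:R - Num.sqrt (2 * n%:R)| <= 2 :> R.
Proof.
move=> n0; have /andP[] := triangular_root_real_bounds R n.-1.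
move: (triangular_root n.-1) => k le lt.
have n1 : n%:R = n.-1%:R + 1 :> R by rewrite natr1 prednK.
have q_ge0 := sqrtr_ge0 (2 * n%:R : R).
have q2 : Num.sqrt (2 * n%:R : R) ^+ 2 = 2 * n%:R.
  by rewrite sqr_sqrtr // mulr_ge0.
have k_ge0 : 0 <= k%:R :> R by [].
move: q_ge0 q2; set q := Num.sqrt _ => q_ge0 q2.
have lo : k%:R <= q by rewrite -ler_sqr ?nnegrE // q2; nra.
have hi : q <= k%:R + 2.
  by rewrite -ler_sqr ?nnegrE ?addr_ge0 ?mulr_ge0 // q2; nra.
by rewrite ler_norml; apply/andP; split; lra.
Qed.

Lemma u_equiv (R : realType) :
  (fun n : nat => (u R n.-1)%:~R : R^o) ~_\oo
  (fun n : nat => Num.sqrt (2 * n%:R) : R^o).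
Proof.
apply/eqaddoP => eps eps_gt0; near=> n.
have n0 : (0 < n)%N by near: n; exact: nbhs_infty_ge.
rewrite /= !fctE u_triangular_root -pmulrn.
apply: le_trans (triangular_root_sqrt R n0) _.
(* This makes 2 <= eps * sqrt (2n), as 4 <= eps^2 * 2n. *)
have : 2 / eps ^+ 2 <= n%:R by near: n; exact: nbhs_infty_ger.
rewrite ler_pdivrMr ?exprn_gt0 // => le.
have q_ge0 := sqrtr_ge0 (2 * n%:R : R).
rewrite ger0_norm //.
have q2 : Num.sqrt (2 * n%:R : R) ^+ 2 = 2 * n%:R.
  by rewrite sqr_sqrtr // mulr_ge0.
move: q_ge0 q2; set q := Num.sqrt _ => q_ge0 q2.
rewrite -(@ler_sqr _ 2 (eps * q)) ?nnegrE ?mulr_ge0 ?(ltW eps_gt0) //.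
by rewrite exprMn q2; nra.
Unshelve. all: by end_near.
Qed.

Theorem theorem1p9 (R : realType) :
  [/\ forall n : nat, (1 <= n)%N ->
        [/\ tree_on n (star_graph n),
            tree_on n (path_graph n)
          & forall T : sgraph, tree_on n T ->
              (sum_color_cost (star_graph n) <= sum_color_cost T)%N /\
              (sum_color_cost T <= sum_color_cost (path_graph n))%N],
      forall (n : nat) (T : sgraph), (1 <= n)%N -> tree_on n T ->
        [/\ n%:Z + u R n.-1 = (sum_color_cost (star_graph n))%:Z,
            (sum_color_cost (star_graph n) <= sum_color_cost T)%N,
            (sum_color_cost T <= sum_color_cost (path_graph n))%N
          & sum_color_cost (path_graph n) = ((3 * n) %/ 2)%N]
    & (fun n : nat => (u R n.-1)%:~R : R^o) ~_\oo
      (fun n : nat => Num.sqrt (2 * n%:R) : R^o)].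
Proof.
have extremal n T : (1 <= n)%N -> tree_on n T ->
    (sum_color_cost (star_graph n) <= sum_color_cost T)%N /\
    (sum_color_cost T <= sum_color_cost (path_graph n))%N.
  move=> n1 treeT; rewrite sum_color_cost_star // sum_color_cost_path //.
  by rewrite sum_color_cost_tree_ge ?sum_color_cost_tree_le.
split=> [n n1|n T n1 treeT|]; last exact: u_equiv.
  split; [exact: star_graph_tree | exact: path_graph_tree |].
  by move=> T; exact: extremal.
have [star_le le_path] := extremal n T n1 treeT.
split=> //; last exact: sum_color_cost_path.
by rewrite sum_color_cost_star // u_triangular_root PoszD.
Qed.
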